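(* Let $n>2$ and $t>2$ be two positive integers. Then \[\varphi(S_n\boxdot S_t)=\begin{cases} 2n+1, & \text{if } n\leq \frac {t+1}2,\\ t+2, & \text{if } \frac {t+1}2<n<t,\\ \min\{n,t+3\}+2, & \text{otherwise}. \end{cases}\]
   Context: All graphs are finite and simple. $S_n$ denotes the star with $n$ leaves (so it has $n+1$ vertices). The subdivision graph $S(G)$ of a graph $G$ is obtained by inserting one new vertex into every edge of $G$. For graphs $G$ and $H$, with $V(G)=\{u_0,\ldots,u_{m-1}\}$, the subdivision-vertex neighbourhood corona (SVN corona) $G\boxdot H$ is the graph obtained from $S(G)$ by adding $m$ vertex-disjoint copies of $H$ (one for each $u_i$) and joining, for each $i$, every vertex of $N_{S(G)}(u_i)$ (the neighbourhood of $u_i$ in $S(G)$) to every vertex of the copy of $H$ associated with $u_i$. A $b$-chromatic coloring of a graph with $k$ colors is a proper coloring with colors $0,\ldots,k-1$ such that, for each color $i$, there is a vertex (a $b$-vertex) of color $i$ having, for each color $j\neq i$, a neighbour of color $j$. The $b$-chromatic number $\varphi(G)$ is the maximum $k$ for which $G$ has a $b$-chromatic coloring with $k$ colors. *)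

(* Defs.v *)
From HB Require Import structures.
From mathcomp Require Import all_boot.

Set Implicit Arguments.
Unset Strict Implicit.
Unset Printing Implicit Defensive.

Record sgraph := SGraph {
  vertex :> finType;
  adj : rel vertex;
  adj_sym : symmetric adj;
  adj_irrefl : irreflexive adj
}.

(* The centre is [None], the leaves are the [Some i]; adjacency is xor. *)
Section Star.
Variable n : nat.

Definition star_adj : rel (option 'I_n) := fun x y => isSome x (+) isSome y.

Lemma star_adj_sym : symmetric star_adj.
Proof. by move=> x y; rewrite /star_adj addbC. Qed.

Lemma star_adj_irrefl : irreflexive star_adj.
Proof. by move=> x; rewrite /star_adj addbb. Qed.

Definition star : sgraph := SGraph star_adj_sym star_adj_irrefl.
End Star.

Section Subdivision.
Variable G : sgraph.

Definition is_edge (e : {set G}) : bool :=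
  [exists x : G, exists y : G, adj x y && (e == [set x; y])].

Definition edge : finType := {e : {set G} | is_edge e}.

Definition subdiv_adj : rel (G + edge)%type := fun a b =>
  match a, b with
  | inl x, inr e => x \in val e
  | inr e, inl x => x \in val e
  | _, _ => false
  end.

Lemma subdiv_adj_sym : symmetric subdiv_adj.
Proof. by move=> [x|e] [y|f]. Qed.

Lemma subdiv_adj_irrefl : irreflexive subdiv_adj.
Proof. by move=> [x|e]. Qed.

Definition subdivision : sgraph := SGraph subdiv_adj_sym subdiv_adj_irrefl.
End Subdivision.

(* [inr (u, h)] is the vertex [h] of the copy of [H] associated with [u]. *)
Section SVNCorona.
Variables G H : sgraph.

Definition svn_corona_adj : rel (subdivision G + G * H)%type := fun a b =>
  match a, b with
  | inl v, inl w => adj v w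
  | inr p, inr q => (p.1 == q.1) && adj p.2 q.2
  | inl v, inr p => @adj (subdivision G) (inl p.1) v
  | inr p, inl v => @adj (subdivision G) (inl p.1) v
  end.

Lemma svn_corona_adj_sym : symmetric svn_corona_adj.
Proof.
move=> [v|p] [w|q] //=; first exact: subdiv_adj_sym.
by rewrite eq_sym adj_sym.
Qed.

Lemma svn_corona_adj_irrefl : irreflexive svn_corona_adj.
Proof. by move=> [v|p] /=; rewrite ?subdiv_adj_irrefl ?adj_irrefl ?andbF. Qed.

Definition svn_corona : sgraph :=
  SGraph svn_corona_adj_sym svn_corona_adj_irrefl.
End SVNCorona.

Section BChromatic.
Variable G : sgraph.

Definition proper_coloring k (c : {ffun G -> 'I_k}) : bool :=
  [forall x, forall y, adj x y ==> (c x != c y)].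

Definition b_vertex k (c : {ffun G -> 'I_k}) (v : G) : bool :=
  [forall j : 'I_k, (j != c v) ==> [exists w, adj v w && (c w == j)]].

Definition b_coloring k (c : {ffun G -> 'I_k}) : bool :=
  proper_coloring c && [forall i, exists v, (c v == i) && b_vertex c v].

Definition b_colorable k : bool := [exists c : {ffun G -> 'I_k}, b_coloring c].

(* Restricting to [k <= #|G|] loses nothing, by [b_colorable_leq_card]. *)
Definition b_chromatic : nat := \max_(k < #|G|.+1 | b_colorable k) k.

Lemma b_colorable_leq_card k : b_colorable k -> k <= #|G|.
Proof.
case/existsP=> c /andP[_ /forallP bP].
have sv i : exists v, c v == i.
  by have /existsP[v /andP[cv _]] := bP i; exists v.
pose g i := xchoose (sv i).
have gK : cancel g c by move=> i; apply/eqP/(xchooseP (sv i)).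
by have := leq_card g (can_inj gK); rewrite card_ord.
Qed.

Lemma b_colorable_leq k : b_colorable k -> k <= b_chromatic.
Proof.
move=> bk; have le_k := b_colorable_leq_card bk.
exact: (@leq_bigmax_cond _ (fun i : 'I_#|G|.+1 => b_colorable i)
          (fun i => i : nat) (Ordinal (le_k : k < #|G|.+1)) bk).
Qed.

Lemma b_colorable_b_chromatic k : b_colorable k -> b_colorable b_chromatic.
Proof.
move=> bk; have le_k := b_colorable_leq_card bk.
rewrite /b_chromatic (bigmax_eq_arg (Ordinal (le_k : k < #|G|.+1))) //.
by case: arg_maxnP.
Qed.
End BChromatic.

(* Main.v *)
(** Write [E] for the set of colours of the vertices subdividing the star.  The
    centre and the leaves of the copy of [S_t] at the centre of [S_n] see all of
    them, so [#|E| <= k - 2], whence the centre of [S_n] is never a b-vertex and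
    a leaf of the central copy is one only if [#|E| = k - 2].  If [k > t + 2],
    degrees leave only the subdivision vertices and the central copy as
    b-vertices; the colour of a leaf of the central copy then forces
    [#|E| = k - 2], so [k <= n + 2], and counting the colours around a
    subdivision vertex gives [k <= t + 5].  In general at most [n] colours come
    from each of the subdivision vertices and the centres of the peripheral
    copies, and one more from the centre of the central copy, so
    [k <= 2 * n + 1].

    Conversely, if [k <= t + 2], each subdivision vertex and the centre of the
    adjacent copy can be given any two distinct colours and both made b-vertices
    by putting the other colours on the leaves of that copy.  If [k > t + 2],
    take [k - 2] colours for [E] and the other two for the central copy; the
    [t + 2] private neighbours of a subdivision vertex suffice to show it the
    rest of [E]. *)

Require Import Defs.
From mathcomp Require Import all_boot zify.

Set Implicit Arguments.
Unset Strict Implicit.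
Unset Printing Implicit Defensive.

(** * Neighbourhood bound for b-vertices, and colourings by natural numbers *)

Section BColoring.
Variables (G : sgraph) (k : nat).

Lemma proper_coloring_neq (c : {ffun G -> 'I_k}) x y :
  proper_coloring c -> adj x y -> c x != c y.
Proof. by move=> /forallP/(_ x)/forallP/(_ y)/implyP. Qed.

Lemma b_vertex_leq_card (c : {ffun G -> 'I_k}) v (S : {set 'I_k}) :
  b_vertex c v -> (forall w, adj v w -> c w \in S) -> k <= #|S|.+1.
Proof.
move=> /forallP bv vS.
have sub : [set: 'I_k] \subset c v |: S.
  apply/subsetP=> j _; rewrite in_setU1; case: eqP => //= /eqP ne.
  have /existsP[w /andP[vw /eqP <-]] := implyP (bv j) ne.
  exact: vS.
have := subset_leq_card sub.
rewrite cardsT card_ord cardsU1; case: (_ \notin _) => /=; lia.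
Qed.

(** Colours in [nat] keep the explicit colourings below within reach of [lia]. *)
Lemma b_colorable_nat (col : G -> nat) :
    (forall v, col v < k) ->
    (forall x y, adj x y -> col x <> col y) ->
    (forall i, i < k -> exists2 v, col v = i &
       forall j, j < k -> j <> i -> exists2 w, adj v w & col w = j) ->
  b_colorable G k.
Proof.
move=> lt_col pr bv; apply/existsP; exists [ffun v => Ordinal (lt_col v)].
apply/andP; split.
  apply/forallP=> x; apply/forallP=> y; apply/implyP=> xy.
  by rewrite !ffunE; apply/eqP=> -[]; apply: pr.
apply/forallP=> i; have [v ci bvi] := bv i (ltn_ord i).
apply/existsP; exists v; apply/andP; split.
  by apply/eqP/val_inj; rewrite /= ffunE.
apply/forallP=> j; apply/implyP=> ne.
have [|w vw cw] := bvi j (ltn_ord j).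
  move=> eji; move/eqP: ne; apply; apply: val_inj.
  by rewrite /= ffunE /= ci eji.
apply/existsP; exists w; rewrite vw /=.
by apply/eqP/val_inj; rewrite /= ffunE.
Qed.
End BColoring.

Arguments b_vertex_leq_card {G k c v} S.

(** * Edges of the star, indexed by its leaves *)

Section StarEdges.
Variable n : nat.

Fact star_edge_subproof (i : 'I_n) : is_edge [set (None : star n); Some i].
Proof. by apply/existsP; exists None; apply/existsP; exists (Some i) => /=. Qed.

Definition star_edge (i : 'I_n) : edge (star n) :=
  exist _ [set (None : star n); Some i] (star_edge_subproof i).

Lemma star_edgeP e : exists i, star_edge i == e.
Proof.
have /existsP[x /existsP[y /andP[xy /eqP ve]]] := valP e.
case: x y xy ve => [i|] [j|] //= _ ve; [exists i | exists j];
  by apply/eqP/val_inj; rewrite /= ve // setUC.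
Qed.

Definition star_edge_index e : 'I_n := xchoose (star_edgeP e).

Lemma star_edge_indexK : cancel star_edge_index star_edge.
Proof. by move=> e; apply/eqP/(xchooseP (star_edgeP e)). Qed.

Lemma Some_in_star_edge i j : (Some j \in val (star_edge i)) = (j == i).
Proof. by rewrite /= !inE. Qed.

Lemma None_in_star_edge i : None \in val (star_edge i).
Proof. by rewrite /= !inE. Qed.

Lemma star_edgeK : cancel star_edge star_edge_index.
Proof.
move=> i; have: Some i \in val (star_edge (star_edge_index (star_edge i))).
  by rewrite star_edge_indexK Some_in_star_edge.
by rewrite Some_in_star_edge => /eqP.
Qed.
End StarEdges.

(** * Vertices and adjacency of the corona of two stars *)

Section StarCorona.
Variables n t : nat.
Notation corona := (svn_corona (star n) (star t)).

Definition hub : corona := inl (inl None).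
Definition rim (i : 'I_n) : corona := inl (inl (Some i)).
Definition spoke (i : 'I_n) : corona := inl (inr (star_edge i)).
Definition copy (u : option 'I_n) (h : option 'I_t) : corona := inr (u, h).

Variant star_corona_spec : corona -> Type :=
  | IsHub : star_corona_spec hub
  | IsRim i : star_corona_spec (rim i)
  | IsSpoke i : star_corona_spec (spoke i)
  | IsCopy u h : star_corona_spec (copy u h).

Lemma star_coronaP v : star_corona_spec v.
Proof.
case: v => [[[i|]|e]|[u h]]; try by constructor.
by rewrite -(star_edge_indexK e); apply: IsSpoke.
Qed.

Lemma adj_hub_spoke i : adj hub (spoke i).
Proof. exact: None_in_star_edge. Qed.

Lemma adj_rim_spoke i j : adj (rim i) (spoke j) = (i == j).
Proof. exact: Some_in_star_edge. Qed.

Lemma adj_spoke_copy i u h :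
  adj (spoke i) (copy u h) = (u == None) || (u == Some i).
Proof. by case: u => [j|]; rewrite [LHS]/= !inE ?orbF. Qed.

Lemma adj_copy u h u' h' :
  adj (copy u h) (copy u' h') = (u == u') && (isSome h (+) isSome h').
Proof. by []. Qed.

Definition spoke_color_set k (c : {ffun corona -> 'I_k}) :=
  [set c (spoke i) | i : 'I_n].

(** * Upper bounds on the number of colours *)

Section UpperBound.
Variables (k : nat) (c : {ffun corona -> 'I_k}).
Hypothesis cP : b_coloring c.
Hypotheses (n_gt0 : 0 < n) (t_gt0 : 0 < t).

Notation spoke_colors := (spoke_color_set c).
Notation center := (copy None None).
Notation pendant := (fun j => copy None (Some j)).

Let proper x y : adj x y -> c x != c y.
Proof. by apply: proper_coloring_neq; case/andP: cP. Qed.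

Let b_vertex_of_color i : exists2 v, c v = i & b_vertex c v.
Proof.
by case/andP: cP => _ /forallP/(_ i)/existsP[v /andP[/eqP]]; exists v.
Qed.

Lemma spoke_colors_leq : #|spoke_colors| <= n.
Proof. by rewrite -[n in _ <= n]card_ord; apply: leq_imset_card. Qed.

Lemma spoke_color i : c (spoke i) \in spoke_colors.
Proof. exact: imset_f. Qed.

Lemma hub_color : c hub \notin spoke_colors.
Proof.
by apply/imsetP=> -[i _] /eqP; apply/negP/proper/adj_hub_spoke.
Qed.

Lemma copy_center_color h : c (copy None h) \notin spoke_colors.
Proof.
apply/imsetP=> -[i _] /eqP; apply/negP; rewrite eq_sym.
by apply: proper; rewrite adj_spoke_copy.
Qed.

Lemma center_pendant_color j : c center != c (pendant j).
Proof. exact: proper. Qed.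

Lemma spoke_colors_leq_subn2 : #|spoke_colors| + 2 <= k.
Proof.
pose p := c (pendant (Ordinal t_gt0)).
have := max_card (c center |: (p |: spoke_colors)).
rewrite card_ord !cardsU1 in_setU1 negb_or !copy_center_color.
by rewrite center_pendant_color /=; lia.
Qed.

Lemma hub_not_b_vertex : ~ b_vertex c hub.
Proof.
have le := spoke_colors_leq_subn2; move=> /(b_vertex_leq_card spoke_colors) h.
suff: k <= #|spoke_colors|.+1 by lia.
by apply: h => w; case: (star_coronaP w) => // i _; apply: spoke_color.
Qed.

Lemma pendant_b_vertex j : b_vertex c (pendant j) -> k = #|spoke_colors| + 2.
Proof.
have /= le := spoke_colors_leq_subn2.
move=> /(b_vertex_leq_card (c center |: spoke_colors)) h.
suff: k <= #|c center |: spoke_colors|.+1.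
  by rewrite cardsU1 copy_center_color /=; lia.
apply: h => w; case: (star_coronaP w) => [||i|[u|] [h|]] //.
- by move=> _; rewrite in_setU1 spoke_color orbT.
- by move=> _; rewrite setU11.
Qed.

Lemma rim_b_vertex i : b_vertex c (rim i) -> k <= 2.
Proof.
move=> /(b_vertex_leq_card [set c (spoke i)]); rewrite cards1; apply.
move=> w; case: (star_coronaP w) => // j.
by rewrite adj_rim_spoke => /eqP <-; rewrite set11.
Qed.

Lemma copy_leaf_b_vertex i j : b_vertex c (copy (Some i) (Some j)) -> k <= 3.
Proof.
move=> /(b_vertex_leq_card [set c (spoke i); c (copy (Some i) None)]) h.
apply: leq_trans (h _) _; last by rewrite cards2; case: (_ != _).
move=> w; case: (star_coronaP w) => // [i'|u [j'|]].
- rewrite adj_sym adj_spoke_copy /= => /eqP[<-]; exact: set21.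
- by rewrite adj_copy andbF.
- rewrite adj_copy andbT => /eqP <-; exact: set22.
Qed.

Lemma copy_center_b_vertex i : b_vertex c (copy (Some i) None) -> k <= t + 2.
Proof.
pose S := c (spoke i) |: [set c (copy (Some i) (Some j)) | j : 'I_t].
move=> /(b_vertex_leq_card S) h; apply: leq_trans (h _) _; last first.
  have := leq_imset_card (fun j => c (copy (Some i) (Some j))) 'I_t.
  (* [lia] must see both occurrences of the cardinal as the same term. *)
  by rewrite card_ord cardsU1 /reverse_coercion; case: (_ \notin _) => /=; lia.
move=> w; case: (star_coronaP w) => // [i'|u [j'|]].
- rewrite adj_sym adj_spoke_copy /= => /eqP[<-]; exact: setU11.
- rewrite adj_copy andbT => /eqP <-; apply/setU1P; right.
  by apply/imsetP; exists j'.
- by rewrite adj_copy andbF.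
Qed.

(** The hub and the central copy show only colours outside [spoke_colors]; the rim vertex and the
    peripheral copy add at most [t + 2] colours, and the spoke itself one more. *)
Lemma spoke_b_vertex i :
  b_vertex c (spoke i) -> k <= k - #|spoke_colors| + t + 3.
Proof.
pose L := [set c (copy (Some i) (Some j)) | j : 'I_t].
pose S := c (rim i) |: (c (copy (Some i) None) |: (L :|: ~: spoke_colors)).
move=> /(b_vertex_leq_card S) h; apply: leq_trans (h _) _; last first.
  have := leq_imset_card (fun j => c (copy (Some i) (Some j))) 'I_t.
  have := cardsC spoke_colors; have := (cardsU L (~: spoke_colors)).
  rewrite !cardsU1 !card_ord /reverse_coercion -/L.
  by do 2!case: (_ \notin _) => /=; lia.
move=> w; case: (star_coronaP w) => [|i'|i'|[i'|] h'].
- by rewrite !inE hub_color !orbT.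
- by rewrite adj_sym adj_rim_spoke => /eqP ->; rewrite setU11.
- by [].
- rewrite adj_spoke_copy /= => /eqP[->]; case: h' => [j|].
    do 2!(apply/setU1P; right); apply/setUP; left.
    by apply/imsetP; exists j.
  by rewrite !inE eqxx orbT.
- by rewrite !inE copy_center_color !orbT.
Qed.

Lemma large_b_coloring_leq : t + 3 <= k -> k <= minn n (t + 3) + 2.
Proof.
move=> lt_k; have /= le_n := spoke_colors_leq.
have /= le2 := spoke_colors_leq_subn2.
(* Only a pendant can be a b-vertex of this colour: spokes and [center] are adjacent to
   [pendant j0], and the other kinds fail by degree. *)
have /= k_eq : k = #|spoke_colors| + 2.
  pose j0 := Ordinal t_gt0.
  have [v cv] := b_vertex_of_color (c (pendant j0)).
  case: (star_coronaP v) cv => [_|i _|i|[i|] [j|]].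
  - by move/hub_not_b_vertex.
  - by move/rim_b_vertex; lia.
  - move=> e; case/negP: (copy_center_color (Some j0)).
    by rewrite -e spoke_color.
  - by move=> _ /copy_leaf_b_vertex; lia.
  - by move=> _ /copy_center_b_vertex; lia.
  - by move=> _ /pendant_b_vertex.
  - by move=> /eqP; rewrite (negPf (center_pendant_color _)).
(* The central copy avoids spoke colours, so this b-vertex is a spoke, and [k_eq] turns its bound
   into [k <= t + 5]. *)
have [v cv] := b_vertex_of_color (c (spoke (Ordinal n_gt0))).
have: c v \in spoke_colors by rewrite cv spoke_color.
case: (star_coronaP v) => [_|i _|i _|[i|] [j|]].
- by move/hub_not_b_vertex.
- by move/rim_b_vertex; lia.
- by move/spoke_b_vertex => /=; lia.
- by move=> _ /copy_leaf_b_vertex; lia.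
- by move=> _ /copy_center_b_vertex; lia.
- by rewrite (negPf (copy_center_color _)).
- by rewrite (negPf (copy_center_color _)).
Qed.

Lemma b_coloring_leq_double : 2 < n -> k <= 2 * n + 1.
Proof.
move=> n_gt2; rewrite leqNgt; apply/negP=> lt_k.
have /= le_n := spoke_colors_leq.
pose L := [set c (copy (Some i) None) | i : 'I_n].
pose S := c center |: (spoke_colors :|: L).
have: [set: 'I_k] \subset S.
  apply/subsetP=> a _; have [v <-] := b_vertex_of_color a.
  case: (star_coronaP v) => [|i|i _|[i|] [j|]].
  - by move/hub_not_b_vertex.
  - by move/rim_b_vertex; lia.
  - by rewrite !inE spoke_color ?orbT.
  - by move=> /copy_leaf_b_vertex; lia.
  - move=> _; apply/setU1P; right; apply/setUP; right.
    by apply/imsetP; exists i.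
  (* A pendant b-vertex would force [k <= n + 2], which is below [2 * n + 2]. *)
  - by move/pendant_b_vertex => /=; lia.
  - by rewrite setU11.
move/subset_leq_card; rewrite cardsT card_ord cardsU1 cardsU.
have := leq_imset_card (fun i => c (copy (Some i) None)) 'I_n.
rewrite card_ord /reverse_coercion -/L; move: le_n => /=.
by case: (_ \notin _); lia.
Qed.
End UpperBound.

(** * Explicit colourings *)

Section LowerBound.
Variables (k hubc centerc : nat) (rimc spokec pendantc copyc : nat -> nat).
Variable leafc : nat -> nat -> nat.

Definition star_corona_coloring (v : corona) : nat :=
  match v with
  | inl (inl None) => hubc
  | inl (inl (Some i)) => rimc i
  | inl (inr e) => spokec (star_edge_index e)
  | inr (None, None) => centerc
  | inr (None, Some j) => pendantc j
  | inr (Some i, None) => copyc i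
  | inr (Some i, Some j) => leafc i j
  end.
Notation col := star_corona_coloring.

Lemma star_corona_coloring_spoke i : col (spoke i) = spokec i.
Proof. by rewrite /= star_edgeK. Qed.

Hypotheses
  (hubP : forall i, i < n -> hubc <> spokec i)
  (rimP : forall i, i < n -> rimc i <> spokec i)
  (centerP : forall i, i < n -> centerc <> spokec i)
  (pendantP : forall i j, i < n -> j < t -> pendantc j <> spokec i)
  (center_pendantP : forall j, j < t -> centerc <> pendantc j)
  (copyP : forall i, i < n -> copyc i <> spokec i)
  (leafP : forall i j, i < n -> j < t -> leafc i j <> spokec i)
  (copy_leafP : forall i j, i < n -> j < t -> copyc i <> leafc i j).

Lemma star_corona_coloring_spoke_proper i w :
  adj (spoke i) w -> col w <> col (spoke i).
Proof.
rewrite star_corona_coloring_spoke.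
case: (star_coronaP w) => // [_|j|u h]; first exact: hubP.
  by rewrite adj_sym adj_rim_spoke => /eqP ->; exact: rimP.
rewrite adj_spoke_copy; case: u h => [u|] [j|] //=.
- by move=> /eqP[->]; exact: leafP.
- by move=> /eqP[->]; exact: copyP.
- by move=> _; exact: pendantP.
- by move=> _; exact: centerP.
Qed.

(** Every edge either ends in a spoke or lies inside one copy. *)
Lemma star_corona_coloring_proper x y : adj x y -> col x <> col y.
Proof.
case: (star_coronaP x); last 1 first.
- case: (star_coronaP y) => // [i|u' h'] u h.
    by rewrite adj_sym => /star_corona_coloring_spoke_proper.
  rewrite adj_copy => /andP[/eqP ->].
  case: u' h h' => [i|] [j|] [j'|] //= _.
  + exact/nesym/copy_leafP.
  + exact: copy_leafP.
  + exact/nesym/center_pendantP.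
  + exact: center_pendantP.
- case: (star_coronaP y) => // i.
  by rewrite adj_sym => /star_corona_coloring_spoke_proper.
- case: (star_coronaP y) => // i j.
  by rewrite adj_sym => /star_corona_coloring_spoke_proper.
- by move=> i /star_corona_coloring_spoke_proper/nesym.
Qed.
End LowerBound.

Lemma b_colorable_large m :
  2 < m -> m <= n -> m <= t + 3 -> 0 < t -> b_colorable corona (m + 2).
Proof.
move=> m_gt2 le_mn le_mt t_gt0.
(* The first [m] spokes get distinct colours; any further ones repeat [m - 1]. *)
pose s i := minn i (m - 1).
(* [bump (s i)] enumerates the colours below [m] other than [s i]. *)
pose l i j := bump (s i) (minn (j + 2) (m - 2)).
(* Index 0 of the enumeration goes to the copy centre, 1 to the rim vertex, the rest to the leaves.
   The hub and [copy None None] share [m]; the pendants get [m.+1]. *)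
pose col := star_corona_coloring m m (fun i => bump (s i) 1) s (fun=> m.+1)
  (fun i => bump (s i) 0) l.
have l_onto i a : a < m -> a <> s i -> a <> bump (s i) 0 -> a <> bump (s i) 1 ->
    exists j : 'I_t, l i j = a.
  move=> lt_a ne_s ne_0 ne_1.
  (* The index of [a] is at least 2 and at most [m - 2], hence at most [t + 1]. *)
  have lt_j : unbump (s i) a - 2 < t.
    by move: ne_s ne_0 ne_1; rewrite /s /unbump /bump; lia.
  exists (Ordinal lt_j); move: ne_s ne_0 ne_1.
  by rewrite /l /s /unbump /bump /=; lia.
apply: (@b_colorable_nat _ _ col).
- move=> v; case: (star_coronaP v) => [|i|i|[i|] [j|]];
    rewrite /col ?star_corona_coloring_spoke /= /l /s /bump; lia.
- by apply: star_corona_coloring_proper => *; rewrite /l /s /bump; lia.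
have col_spoke a : a < m -> exists i : 'I_n, col (spoke i) = a.
  move=> lt_a; exists (Ordinal (leq_trans lt_a le_mn)).
  by rewrite /col star_corona_coloring_spoke /s /=; lia.
pose j0 := Ordinal t_gt0.
move=> a lt_a; have [lt_am|] := ltnP a m.
  have [i spoke_i] := col_spoke a lt_am; exists (spoke i) => // d lt_d ne_d.
  have s_i : s i = a by rewrite -spoke_i /col star_corona_coloring_spoke.
  have [->|ne_m] := eqVneq d m.
    by exists hub; rewrite // adj_sym adj_hub_spoke.
  have [->|ne_m1] := eqVneq d m.+1.
    by exists (copy None (Some j0)); rewrite // adj_spoke_copy.
  have [->|/eqP ne_0] := eqVneq d (bump (s i) 0).
    by exists (copy (Some i) None); rewrite ?adj_spoke_copy ?eqxx.
  have [->|/eqP ne_1] := eqVneq d (bump (s i) 1).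
    by exists (rim i); rewrite // adj_sym adj_rim_spoke.
  have [||j lj] := l_onto i d _ _ ne_0 ne_1; [by lia | by rewrite s_i |].
  by exists (copy (Some i) (Some j)); rewrite ?adj_spoke_copy ?eqxx.
(* The centre and a pendant of the central copy see each other and all spokes, hence all the
   remaining colours. *)
move=> le_ma; exists (copy None (if a == m then None else Some j0)).
  by rewrite /col; case: eqP => /= ?; lia.
move=> d lt_d ne_d; have [/col_spoke[i <-]|le_md] := ltnP d m.
  by exists (spoke i); rewrite // adj_sym adj_spoke_copy.
exists (copy None (if d == m then None else Some j0)).
  by rewrite adj_copy eqxx; case: (a =P m); case: (d =P m) => //=; lia.
by rewrite /col; case: eqP => /= ?; lia.
Qed.

Lemma b_colorable_small k :
  n + 2 <= k -> k <= 2 * n + 1 -> k <= t + 2 -> b_colorable corona k.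
Proof.
move=> le_nk le_kn le_kt.
(* Spoke [i] has colour [i], and [h] takes exactly the values from [n] to [k - 2], all of them
   reached because [k <= 2 * n + 1]. Colour [k - 1] is left for the centre of the central copy. *)
pose h i := minn (n + i) (k - 2).
(* As [i < n <= h i], the nested bumps enumerate the colours other than [i] and [h i]; there are
   [k - 2 <= t] of them, the last at index [k - 3]. *)
pose l i j := bump (h i) (bump i (minn j (k - 3))).
pose col := star_corona_coloring (k - 1) (k - 1) h id h h l.
have l_onto i a : i < n -> a < k -> a <> i -> a <> h i ->
    exists j : 'I_t, l i j = a.
  move=> lt_i lt_a ne_i ne_h.
  have lt_j : unbump i (unbump (h i) a) < t.
    by move: ne_i ne_h; rewrite /h /unbump; lia.
  exists (Ordinal lt_j); move: ne_i ne_h.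
  by rewrite /l /h /unbump /bump /=; lia.
apply: (@b_colorable_nat _ _ col).
- move=> v; case: (star_coronaP v) => [|i|i|[i|] [j|]];
    rewrite /col ?star_corona_coloring_spoke /= /l /h /bump;
    try have := ltn_ord i; lia.
- by apply: star_corona_coloring_proper => *; rewrite /l /h /bump; lia.
have col_spoke i : col (spoke i) = i by rewrite /col star_corona_coloring_spoke.
move=> a lt_a; have [lt_an|le_na] := ltnP a n.
  pose i := Ordinal lt_an; exists (spoke i) => // d lt_d ne_d.
  have [->|/eqP ne_h] := eqVneq d (h i).
    by exists (copy (Some i) None); rewrite ?adj_spoke_copy ?eqxx.
  have [//|j lj] := l_onto i d lt_an lt_d _ ne_h.
  by exists (copy (Some i) (Some j)); rewrite ?adj_spoke_copy ?eqxx.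
have [lt_ak|le_ka] := ltnP a (k - 1).
  have lt_i : a - n < n by lia.
  pose i := Ordinal lt_i.
  have h_i : h i = a by rewrite /h /=; lia.
  exists (copy (Some i) None) => // d lt_d ne_d.
  have [->|/eqP ne_i] := eqVneq d i.
    by exists (spoke i); rewrite // adj_sym adj_spoke_copy eqxx.
  have [|j lj] := l_onto i d lt_i lt_d ne_i; first by rewrite h_i.
  by exists (copy (Some i) (Some j)); rewrite // adj_copy eqxx.
exists (copy None None); first by rewrite /col /=; lia.
move=> d lt_d ne_d; have [lt_dn|le_nd] := ltnP d n.
  by exists (spoke (Ordinal lt_dn)); rewrite // adj_sym adj_spoke_copy.
have lt_j : d - n < t by lia.
exists (copy None (Some (Ordinal lt_j))) => //.
by rewrite /col /= /h; lia.
Qed.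
End StarCorona.

Theorem theorem18 (n t : nat) (hn : 2 < n) (ht : 2 < t) :
  b_chromatic (svn_corona (star n) (star t)) =
    if 2 * n <= t + 1 then 2 * n + 1
    else if n < t then t + 2
    else minn n (t + 3) + 2.
Proof.
apply/eqP; rewrite eqn_leq; apply/andP; split.
  have n_gt0 : 0 < n by lia.
  have t_gt0 : 0 < t by lia.
  apply/bigmax_leqP=> k /existsP[c cP].
  have le_2n := b_coloring_leq_double cP n_gt0 t_gt0 hn.
  (* If [t + 3 <= k], then [k <= n + 2] makes [n] exceed [t], which excludes the middle case. If
     [k <= t + 2] and [t <= n], the last value is already at least [t + 2]. *)
  have [/(large_b_coloring_leq cP n_gt0 t_gt0) le_min|lt_k] := leqP (t + 3) k;
    by case: (leqP (2 * n) (t + 1)) => ?; case: (ltnP n t) => ?; lia.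
apply: b_colorable_leq.
case: (leqP (2 * n) (t + 1)) => le_nt; first by apply: b_colorable_small; lia.
case: (ltnP n t) => lt_nt; first by apply: b_colorable_small; lia.
by apply: b_colorable_large; lia.
Qed.
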